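(* Let $C=M^*(2)$ be the smallest nonassociative simple Moufang loop (of order $120$). Then the probability $p_3(C)$ that $3$ randomly chosen elements of $C$ generate $C$ is $$p_3(C)=955584\cdot 120^{-3}=0.553.$$
   Context: $M^*(2)$ is the Paige loop over the two-element field $\mathbb F_2$: its elements are the Zorn vector matrices $\begin{pmatrix} a&\alpha\\ \beta&b\end{pmatrix}$ with $a,b\in\mathbb F_2$, $\alpha,\beta\in\mathbb F_2^3$ and $ab-\alpha\cdot\beta=1$, multiplied by $$\begin{pmatrix} a&\alpha\\ \beta&b\end{pmatrix}\begin{pmatrix} c&\gamma\\ \delta&d\end{pmatrix}=\begin{pmatrix} ac+\alpha\cdot\delta & a\gamma+d\alpha-\beta\times\delta\\ c\beta+b\delta+\alpha\times\gamma & \beta\cdot\gamma+bd\end{pmatrix},$$ where $\cdot$ and $\times$ are the usual dot and cross products on $\mathbb F_2^3$. It is a Moufang loop with $120$ elements. For a finite loop $C$, $p_m(C)=|C|^{-m}\cdot|\mathrm{Gen}_m(C)|$, where $\mathrm{Gen}_m(C)$ is the set of all ordered $m$-tuples $(a_0,\dots,a_{m-1})\in C^m$ (repetitions allowed) such that the subloop generated by $a_0,\dots,a_{m-1}$ is $C$. *)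

(* Defs.v *)
From HB Require Import structures.
From mathcomp Require Import all_boot all_order all_algebra.
From mathcomp Require Import ring.

Set Implicit Arguments.
Unset Strict Implicit.
Unset Printing Implicit Defensive.

Import GRing.Theory.

Local Open Scope group_scope.

(* A loop: a unitary magma in which a * x = b and y * a = b are uniquely
   solvable, presented by its two division operations
   ldiv a b = a \ b and rdiv b a = b / a. *)
HB.mixin Record UMagma_isLoop C of UMagma C := {
  ldiv : C -> C -> C;
  rdiv : C -> C -> C;
  mulg_ldiv : forall a b : C, a * ldiv a b = b;
  ldiv_mulg : forall a x : C, ldiv a (a * x) = x;
  rdiv_mulg : forall b a : C, rdiv b a * a = b;
  mulg_rdiv : forall y a : C, rdiv (y * a) a = y
}.

#[short(type="finLoopType")]
HB.structure Definition FinLoop := {C of UMagma_isLoop C & UMagma C & Finite C}.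

Section Generation.
Variable C : finLoopType.
Implicit Types S A : {set C}.

Definition is_subloop S : bool :=
  (1 \in S) &&
  [forall a in S, forall b in S,
     [&& a * b \in S, ldiv a b \in S & rdiv a b \in S]].

Definition subloop_gen A : {set C} :=
  \bigcap_(S : {set C} | is_subloop S && (A \subset S)) S.

Definition Gen (m : nat) : {set m.-tuple C} :=
  [set t : m.-tuple C | subloop_gen [set x in t] == [set: C]].

Definition gen_prob (m : nat) : rat :=
  (#|Gen m|%:R / #|C|%:R ^+ m)%R.

End Generation.

Arguments Gen : clear implicits.
Arguments gen_prob : clear implicits.

Local Open Scope ring_scope.

Section Vec3.
Variable R : comNzRingType.

Definition dot3 (u v : 'rV[R]_3) : R := \sum_i u 0 i * v 0 i.

(* The indices are added in 'I_3, that is, modulo 3. *)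
Definition cross3 (u v : 'rV[R]_3) : 'rV[R]_3 :=
  \row_(i < 3) (u 0 (i + 1) * v 0 (i + 2) - u 0 (i + 2) * v 0 (i + 1)).

End Vec3.

(* Zorn a alpha beta b is the vector matrix with rows (a, alpha), (beta, b). *)
Record zorn (R : Type) : Type :=
  Zorn { zul : R; zur : 'rV[R]_3; zdl : 'rV[R]_3; zdr : R }.

Definition zorn_tuple (R : Type) (x : zorn R) :=
  (zul x, zur x, zdl x, zdr x).
Definition tuple_zorn (R : Type) (t : R * 'rV[R]_3 * 'rV[R]_3 * R) : zorn R :=
  let: (a, u, v, b) := t in Zorn a u v b.

Lemma zorn_tupleK (R : Type) : cancel (@zorn_tuple R) (@tuple_zorn R).
Proof. by case. Qed.

HB.instance Definition _ (R : eqType) :=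
  Equality.copy (zorn R) (can_type (@zorn_tupleK R)).
HB.instance Definition _ (R : choiceType) :=
  Choice.copy (zorn R) (can_type (@zorn_tupleK R)).
HB.instance Definition _ (R : countType) :=
  Countable.copy (zorn R) (can_type (@zorn_tupleK R)).
HB.instance Definition _ (R : finType) :=
  Finite.copy (zorn R) (can_type (@zorn_tupleK R)).

Section ZornAlgebra.
Variable R : comNzRingType.
Implicit Types x y z : zorn R.

Definition zorn_det x : R := zul x * zdr x - dot3 (zur x) (zdl x).

Definition zorn_one : zorn R := Zorn 1 0 0 1.

Definition zorn_mul x y : zorn R :=
  let: Zorn a al be b := x in
  let: Zorn c ga de d := y in
  Zorn (a * c + dot3 al de)
       (a *: ga + d *: al - cross3 be de)
       (c *: be + b *: de + cross3 al ga)
       (dot3 be ga + b * d).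

Definition zorn_adj x : zorn R :=
  let: Zorn a al be b := x in Zorn b (- al) (- be) a.

Lemma dot3E (u v : 'rV[R]_3) :
  dot3 u v = u 0 0 * v 0 0 + u 0 1 * v 0 1 + u 0 2 * v 0 2.
Proof.
rewrite /dot3 !big_ord_recl big_ord0 addr0 addrA.
by congr (_ + u 0 _ * v 0 _ + u 0 _ * v 0 _); apply: val_inj.
Qed.

Lemma cross3E (u v : 'rV[R]_3) :
  (cross3 u v 0 0 = u 0 1 * v 0 2 - u 0 2 * v 0 1) *
  (cross3 u v 0 1 = u 0 2 * v 0 0 - u 0 0 * v 0 2) *
  (cross3 u v 0 2 = u 0 0 * v 0 1 - u 0 1 * v 0 0).
Proof.
by split; [split|]; rewrite mxE; congr (u 0 _ * v 0 _ - u 0 _ * v 0 _);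
  apply: val_inj.
Qed.

Lemma row3P (u v : 'rV[R]_3) :
  u 0 0 = v 0 0 -> u 0 1 = v 0 1 -> u 0 2 = v 0 2 -> u = v.
Proof.
move=> e0 e1 e2; apply/rowP => -[[|[|[|//]]] lt_i].
- by rewrite (_ : Ordinal lt_i = 0) //; apply: val_inj.
- by rewrite (_ : Ordinal lt_i = 1) //; apply: val_inj.
- by rewrite (_ : Ordinal lt_i = 2) //; apply: val_inj.
Qed.

Lemma zornP x y :
  zul x = zul y -> zur x = zur y -> zdl x = zdl y -> zdr x = zdr y -> x = y.
Proof. by case: x y => [? ? ? ?] [? ? ? ?] /= -> -> -> ->. Qed.

Ltac zorn_ring :=
  apply: zornP => /=; [|apply: row3P|apply: row3P|];
  rewrite ?(cross3E, dot3E, mxE) /=; ring.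

Lemma zorn_mul1 x : zorn_mul zorn_one x = x.
Proof. by case: x => *; zorn_ring. Qed.

Lemma zorn_mulr1 x : zorn_mul x zorn_one = x.
Proof. by case: x => *; zorn_ring. Qed.

Lemma zorn_detM x y : zorn_det (zorn_mul x y) = zorn_det x * zorn_det y.
Proof.
case: x y => [a u v b] [c w z d].
by rewrite /zorn_det /= ?(cross3E, dot3E, mxE) /=; ring.
Qed.

Lemma zorn_det1 : zorn_det zorn_one = 1.
Proof. by rewrite /zorn_det /= dot3E !mxE; ring. Qed.

Lemma zorn_det_adj x : zorn_det (zorn_adj x) = zorn_det x.
Proof. by case: x => *; rewrite /zorn_det /= !dot3E !mxE; ring. Qed.

Lemma zorn_adjK x : zorn_adj (zorn_adj x) = x.
Proof. by case: x => *; rewrite /= !opprK. Qed.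

Lemma zorn_mulKl x y : zorn_det x = 1 ->
  zorn_mul (zorn_adj x) (zorn_mul x y) = y.
Proof.
move=> dx; rewrite -[RHS]/y.
have -> : zorn_mul (zorn_adj x) (zorn_mul x y) =
  Zorn (zorn_det x * zul y) (zorn_det x *: zur y)
       (zorn_det x *: zdl y) (zorn_det x * zdr y).
  by case: x y {dx} => [a u v b] [c w z d]; rewrite /zorn_det; zorn_ring.
by rewrite dx !mul1r !scale1r; case: y.
Qed.

Lemma zorn_mulKr x y : zorn_det y = 1 ->
  zorn_mul (zorn_mul x y) (zorn_adj y) = x.
Proof.
move=> dy.
have -> : zorn_mul (zorn_mul x y) (zorn_adj y) =
  Zorn (zorn_det y * zul x) (zorn_det y *: zur x)
       (zorn_det y *: zdl x) (zorn_det y * zdr x).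
  by case: x y {dy} => [a u v b] [c w z d]; rewrite /zorn_det; zorn_ring.
by rewrite dy !mul1r !scale1r; case: x.
Qed.

Lemma zorn_moufang x y z :
  zorn_mul (zorn_mul x y) (zorn_mul z x) =
  zorn_mul (zorn_mul x (zorn_mul y z)) x.
Proof. by case: x y z => [????] [????] [????]; zorn_ring. Qed.

End ZornAlgebra.

(* M^*(2); over 'F_2 the centre {1, -1} of the loop of Zorn matrices of
   determinant 1 is trivial, so there is no quotient to take. *)
Record paige2 : Type :=
  Paige2 { paige2_val :> zorn 'F_2; _ : zorn_det paige2_val == 1 }.

HB.instance Definition _ := [isSub for paige2_val].
HB.instance Definition _ := [Finite of paige2 by <:].

Section PaigeLoop.
Implicit Types x y : paige2.

Fact paige2_detE x : zorn_det x = 1. Proof. exact/eqP/(valP x). Qed.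

Fact paige2_one_subproof : zorn_det (zorn_one 'F_2) == 1.
Proof. by rewrite zorn_det1. Qed.
Fact paige2_mul_subproof x y : zorn_det (zorn_mul x y) == 1.
Proof. by rewrite zorn_detM !paige2_detE mulr1. Qed.
Fact paige2_inv_subproof x : zorn_det (zorn_adj x) == 1.
Proof. by rewrite zorn_det_adj paige2_detE. Qed.

Definition paige2_one : paige2 := Paige2 paige2_one_subproof.
Definition paige2_mul x y : paige2 := Paige2 (paige2_mul_subproof x y).
Definition paige2_inv x : paige2 := Paige2 (paige2_inv_subproof x).

Fact paige2_mul1 : left_id paige2_one paige2_mul.
Proof. by move=> x; apply: val_inj; apply: zorn_mul1. Qed.
Fact paige2_mulr1 : right_id paige2_one paige2_mul.
Proof. by move=> x; apply: val_inj; apply: zorn_mulr1. Qed.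

HB.instance Definition _ := hasMul.Build paige2 paige2_mul.
HB.instance Definition _ :=
  Magma_isUMagma.Build paige2 paige2_mul1 paige2_mulr1.

Fact paige2_invK x : paige2_inv (paige2_inv x) = x.
Proof. by apply: val_inj; apply: zorn_adjK. Qed.
Fact paige2_mulKl x y : (paige2_inv x * (x * y))%g = y.
Proof. by apply/val_inj/zorn_mulKl/paige2_detE. Qed.
Fact paige2_mulKr x y : (x * y * paige2_inv y)%g = x.
Proof. by apply/val_inj/zorn_mulKr/paige2_detE. Qed.
Fact paige2_mulVKl x y : (x * (paige2_inv x * y))%g = y.
Proof. by rewrite -{1}[x]paige2_invK paige2_mulKl. Qed.
Fact paige2_mulVKr x y : (x * paige2_inv y * y)%g = x.
Proof. by rewrite -{2}[y]paige2_invK paige2_mulKr. Qed.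

HB.instance Definition _ :=
  @UMagma_isLoop.Build paige2
    (fun a b => paige2_inv a * b)%g (fun b a => b * paige2_inv a)%g
    paige2_mulVKl paige2_mulKl paige2_mulVKr paige2_mulKr.

Lemma paige2_moufang (x y z : paige2) :
  ((x * y) * (z * x) = (x * (y * z)) * x)%g.
Proof. by apply: val_inj; apply: zorn_moufang. Qed.

End PaigeLoop.

(* Main.v *)
(* By the Moufang identities the subloop generated by a set A is the orbit of 1
   under the left and right translations by elements of A, so subloops can be
   computed by a graph search.  If x^3 = 1 then conjugation by x is an
   automorphism of M*(2); these automorphisms act transitively on the 63
   involutions and on the 56 elements of order 3.  Hence only the generating
   triples starting with one fixed involution (6528 of them) or one fixed
   element of order 3 (9720) have to be counted; triples starting with 1 never
   generate.  In the count, the possible next generators are grouped into cosets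
   Hx of the subloop H generated so far, since H and hx generate the same
   subloop as H and x. *)
Require Import Defs.
From mathcomp Require Import all_boot all_order all_algebra.
From mathcomp Require Import ring.
Set Implicit Arguments.
Unset Strict Implicit.
Unset Printing Implicit Defensive.

(** * Generated subloops of a finite loop, and counting generating tuples *)

Section FiniteLoops.
Local Open Scope group_scope.
Variable C : finLoopType.
Implicit Types (x y z : C) (A B S : {set C}) (gs : seq C).

Lemma loop_mulI x : injective (fun y : C => x * y).
Proof. exact: can_inj (ldiv_mulg x). Qed.

Lemma loop_mulIr x : injective (fun y : C => y * x).
Proof. exact: (can_inj (g := fun y => rdiv y x)) (mulg_rdiv^~ x). Qed.

Lemma is_subloopP S :
  reflect (1 \in S /\ {in S &, forall x y,
             [/\ x * y \in S, ldiv x y \in S & rdiv x y \in S]})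
          (is_subloop S).
Proof.
apply: (iffP andP) => -[S1 cS]; split=> //.
  by move=> x y Sx Sy; apply/and3P; apply: (forall_inP (forall_inP cS x Sx)).
by apply/forall_inP => x Sx; apply/forall_inP => y Sy; apply/and3P/cS.
Qed.

(** Comparing cardinalities: $f(S)\subseteq S$ has as many elements as $S$, hence equals $S$. *)
Lemma inj_stable_ex (f : C -> C) S :
  injective f -> {homo f : x / x \in S} ->
  forall x, x \in S -> exists2 y, y \in S & x = f y.
Proof.
move=> f_inj fS x Sx; apply/imsetP.
have /subset_leqif_cards : f @: S \subset S.
  by apply/subsetP => _ /imsetP[y Sy ->]; apply: fS.
by rewrite card_imset // => -[_]; rewrite eqxx => /esym/eqP->.
Qed.

Lemma ldiv_stable S x y :
  {homo (fun z => x * z) : z / z \in S} -> y \in S -> ldiv x y \in S.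
Proof.
move=> xS Sy; have [z Sz ->] := inj_stable_ex (@loop_mulI x) xS Sy.
by rewrite ldiv_mulg.
Qed.

Lemma rdiv_stable S x y :
  {homo (fun z => z * x) : z / z \in S} -> y \in S -> rdiv y x \in S.
Proof.
move=> xS Sy; have [z Sz ->] := inj_stable_ex (@loop_mulIr x) xS Sy.
by rewrite mulg_rdiv.
Qed.

(** By finiteness the translations by elements of [S] permute [S], so their inverses, the divisions,
    preserve it as well. *)
Lemma mul_closed_subloop S :
  1 \in S -> {in S &, forall x y, x * y \in S} -> is_subloop S.
Proof.
move=> S1 SM; apply/is_subloopP; split=> // x y Sx Sy; split.
- exact: SM.
- by apply: ldiv_stable => // z Sz; apply: SM.
- by apply: rdiv_stable => // z Sz; apply: SM.
Qed.

Lemma sub_subloop_gen A : A \subset subloop_gen A.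
Proof. by apply/bigcapsP => S /andP[]. Qed.

Lemma subloop_gen_min A S :
  is_subloop S -> A \subset S -> subloop_gen A \subset S.
Proof. by move=> loopS sAS; apply: bigcap_inf; rewrite loopS. Qed.

Lemma subloop_genP A : is_subloop (subloop_gen A).
Proof.
apply: mul_closed_subloop => [|x y /bigcapP Sx /bigcapP Sy]; apply/bigcapP.
  by move=> S /andP[/is_subloopP[]].
move=> S SA; have [_ /(_ x y (Sx S SA) (Sy S SA))[]//] :=
  is_subloopP _ (proj1 (andP SA)).
Qed.

Lemma subloop_gen_subset A B :
  A \subset subloop_gen B -> subloop_gen A \subset subloop_gen B.
Proof. exact/subloop_gen_min/subloop_genP. Qed.

Lemma eq_subloop_genU1 x A B :
  subloop_gen A = subloop_gen B -> subloop_gen (x |: A) = subloop_gen (x |: B).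
Proof.
have sub A1 B1 : subloop_gen A1 = subloop_gen B1 ->
    subloop_gen (x |: A1) \subset subloop_gen (x |: B1).
  move=> eqAB; apply: subloop_gen_subset; rewrite subUset; apply/andP; split.
    exact: subset_trans (subsetUl _ _) (sub_subloop_gen _).
  apply: subset_trans (sub_subloop_gen _) _; rewrite eqAB.
  apply: subloop_gen_subset.
  exact: subset_trans (subsetUr _ _) (sub_subloop_gen _).
by move=> eqAB; apply/eqP; rewrite eqEsubset !sub.
Qed.

(** The element $x$ is recovered from $hx$ through left division by $h$, which lies in both
    generated subloops. *)
Lemma subloop_gen_coset h x A :
  h \in subloop_gen A -> subloop_gen (h * x |: A) = subloop_gen (x |: A).
Proof.
have gen1 y B : y \in subloop_gen (y |: B).
  by apply: subsetP (sub_subloop_gen _) _ (setU11 _ _).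
have genU y B : B \subset subloop_gen (y |: B).
  exact: subset_trans (subsetUr _ _) (sub_subloop_gen _).
move=> Ah; have Ah' y : h \in subloop_gen (y |: A).
  exact: subsetP (subloop_gen_subset (genU _ _)) _ Ah.
have cl y : {in subloop_gen (y |: A) &, forall u v,
    [/\ u * v \in subloop_gen (y |: A), ldiv u v \in subloop_gen (y |: A)
      & rdiv u v \in subloop_gen (y |: A)]}.
  by have [] := is_subloopP _ (subloop_genP (y |: A)).
apply/eqP; rewrite eqEsubset; apply/andP; split; apply: subloop_gen_subset;
  rewrite subUset sub1set genU andbT.
- by have [] := cl x h x (Ah' x) (gen1 x A).
- by have [_ + _] := cl _ h (h * x) (Ah' _) (gen1 _ A); rewrite ldiv_mulg.
Qed.

Definition span gs : {set C} := subloop_gen [set x in gs].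

Lemma span_loopP gs : is_subloop (span gs).
Proof. exact: subloop_genP. Qed.

Lemma eq_span_cons x gs gs' :
  span gs = span gs' -> span (x :: gs) = span (x :: gs').
Proof. by move=> eq_gs; rewrite /span !set_cons; apply: eq_subloop_genU1. Qed.

Lemma span_coset h x gs : h \in span gs -> span (h * x :: gs) = span (x :: gs).
Proof. by move=> gs_h; rewrite /span !set_cons subloop_gen_coset. Qed.

(** Choosing the generators one at a time makes it possible to exchange lists with equal spans at
    every stage. *)
Fixpoint completions k gs : nat :=
  if k is k'.+1 then (\sum_(x : C) completions k' (x :: gs))%N
  else span gs == setT.

Lemma completionsS k gs :
  completions k.+1 gs = (\sum_(x : C) completions k (x :: gs))%N.
Proof. by []. Qed.

Lemma eq_completions k gs gs' :
  span gs = span gs' -> completions k gs = completions k gs'.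
Proof.
elim: k gs gs' => [|k IHk] gs gs' eq_gs /=; first by rewrite eq_gs.
by apply: eq_bigr => x _; apply: IHk; apply: eq_span_cons.
Qed.

Lemma completions_cons1 k : completions k [:: 1] = completions k [::].
Proof.
apply: eq_completions; apply/eqP; rewrite eqEsubset.
have [span1 _] := is_subloopP _ (span_loopP [::]).
rewrite /span !subloop_gen_subset //; apply/subsetP => x; rewrite inE //.
by rewrite inE => /eqP->.
Qed.

Lemma completions_tuple k gs :
  completions k gs =
  #|[set t : k.-tuple C | span (gs ++ t) == setT]|.
Proof.
elim: k gs => [|k IHk] gs /=.
  rewrite -sum1dep_card big_mkcond /= (bigD1 [tuple]) //= big1 => [|t /negP[]].
    by rewrite cats0; case: eqP.
  by rewrite [t]tuple0.
(* The cardinality becomes a sum of booleans, which splits along the head and the tail of the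
   tuple. *)
have -> : #|[set t : k.+1.-tuple C | span (gs ++ t) == setT]|
    = (\sum_(p : C * k.-tuple C) (span ((p.1 :: gs) ++ p.2) == setT))%N.
  rewrite -sum1dep_card big_mkcond /=.
  rewrite (reindex (fun p : C * k.-tuple C => [tuple of p.1 :: p.2])) /=.
    apply: eq_bigr => -[x t] _ /=.
    have -> : span (gs ++ x :: t) = span (x :: gs ++ t).
      congr subloop_gen; apply/setP => y.
      by rewrite !(inE, mem_cat) orbCA.
    by case: eqP.
  exists (fun t => (thead t, [tuple of behead t])) => [[x t] _|t _] /=.
    by congr (_, _); apply: val_inj.
  by rewrite -tuple_eta.
rewrite -(pair_bigA _ (fun (x : C) (t : k.-tuple C) =>
  nat_of_bool (span ((x :: gs) ++ t) == setT))) /=.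
apply: eq_bigr => x _; rewrite IHk -sum1dep_card big_mkcond /=.
by apply: eq_bigr => t _; case: eqP.
Qed.

Lemma card_Gen k : #|Gen C k| = completions k [::].
Proof. by rewrite completions_tuple; apply: eq_card => t; rewrite !inE. Qed.

(** * Invariance of the count under automorphisms *)

Section Automorphisms.
Variable f : C -> C.
Hypotheses (f_inj : injective f) (fM : {morph f : x y / x * y}).

(** Images and preimages of subloops under [f] are subloops, and by finiteness [f] is bijective. *)
Lemma subloop_gen_morph_setT A :
  (subloop_gen (f @: A) == setT) = (subloop_gen A == setT).
Proof.
have f1 : f 1 = 1 by apply: (@loop_mulI (f 1)); rewrite /= -fM !mulg1.
apply/eqP/eqP => genT; apply/eqP; rewrite -subTset.
  have [gA1 gAM] := is_subloopP _ (subloop_genP A).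
  have: subloop_gen (f @: A) \subset f @: subloop_gen A.
    apply: subloop_gen_min; last exact/imsetS/sub_subloop_gen.
    apply: mul_closed_subloop => [|_ _ /imsetP[x Sx ->] /imsetP[y Sy ->]].
      by rewrite -f1 imset_f.
    by rewrite -fM imset_f //; have [] := gAM x y Sx Sy.
  rewrite genT subTset => /eqP fT; apply/subsetP => x _.
  by rewrite -(mem_imset _ _ f_inj) fT.
have [gA1 gAM] := is_subloopP _ (subloop_genP (f @: A)).
have: subloop_gen A \subset f @^-1: subloop_gen (f @: A).
  apply: subloop_gen_min.
    apply: mul_closed_subloop => [|x y]; rewrite !inE ?f1 ?fM //.
    by move=> Sx Sy; have [] := gAM _ _ Sx Sy.
  by rewrite -sub_imset_pre sub_subloop_gen.
rewrite genT => /subsetP pT; apply/subsetP => x _.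
by have := pT (invF f_inj x) (in_setT _); rewrite inE f_invF.
Qed.

(** Each generator still to be chosen is reindexed by [f], which reduces the claim to the case where
    all generators are fixed. *)
Lemma completions_morph k gs : completions k (map f gs) = completions k gs.
Proof.
elim: k gs => [|k IHk] gs /=.
  rewrite /span -[in RHS]subloop_gen_morph_setT.
  congr (nat_of_bool (subloop_gen _ == _)); apply/setP => y; rewrite !inE.
  by apply/mapP/imsetP => -[x gs_x ->]; exists x; rewrite ?inE // in gs_x *.
by rewrite (reindex_inj f_inj) /=; apply: eq_bigr => x _;
   apply: (IHk (x :: gs)).
Qed.

End Automorphisms.

(** * Generated subloops as orbits of translations *)

Lemma connect_ind (T : finType) (e : rel T) (P : T -> Prop) (x y : T) :
  P x -> (forall u v, P u -> e u v -> P v) -> connect e x y -> P y.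
Proof.
move=> Px eP /connectP[p + ->]; elim: p x Px => //= z p IHp x Px /andP[exz].
exact/IHp/(eP x).
Qed.

Definition translates gs x := [seq a * x | a <- gs] ++ [seq x * a | a <- gs].

Lemma mem_translates gs x y :
  reflect (exists2 a, a \in gs & y = a * x \/ y = x * a)
          (y \in translates gs x).
Proof.
rewrite mem_cat; apply: (iffP orP).
  by case=> /mapP[a gs_a ->]; exists a => //; [left | right].
by case=> a gs_a [] ->; [left | right]; apply: map_f.
Qed.

(* By the Moufang identity, (xy)w = (x(y(w/x)))x and w(yx) = (x((x\w)y))x, so
   the translations by a product lie in the group generated by the
   translations by its factors. *)
Lemma span_translates gs :
  (forall x y z, (x * y) * (z * x) = (x * (y * z)) * x) ->
  span gs =i connect (grel (translates gs)) 1.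
Proof.
move=> moufang; set e := grel _; pose S := [set y | connect e 1 y].
have S1 : 1 \in S by rewrite inE connect0.
have Sgs a y : a \in gs -> y \in S -> a * y \in S /\ y * a \in S.
  rewrite !inE => gs_a Sy; split; apply: connect_trans Sy (connect1 _).
    by apply/mem_translates; exists a; last left.
  by apply/mem_translates; exists a; last right.
(* The elements whose two translations preserve [S] are closed under products by [stabM] and include
   [gs] by [Sgs]. Hence they include all of [S], which is reached from 1 by multiplying with
   elements of [gs]. *)
pose stab u := forall w, w \in S -> u * w \in S /\ w * u \in S.
have stabM x y : stab x -> stab y -> stab (x * y).
  move=> Tx Ty w Sw; split.
    rewrite -{1}[w](rdiv_mulg _ x) moufang.
    apply: (Tx _ _).2; apply: (Tx _ _).1; apply: (Ty _ _).1.
    by apply: rdiv_stable => // z /Tx[].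
  rewrite -{1}[w](mulg_ldiv y) moufang.
  apply: (Ty _ _).2; apply: (Ty _ _).1; apply: (Tx _ _).2.
  by apply: ldiv_stable => // z /Ty[].
have stabS x : x \in S -> stab x.
  rewrite inE; apply: connect_ind => [w Sw|u v Tu].
    by rewrite mul1g mulg1.
  case/mem_translates => a gs_a [] ->; apply: stabM => // w; exact: Sgs.
have loopS : is_subloop S.
  by apply: mul_closed_subloop => // x y Sx Sy; have [] := stabS x Sx y Sy.
move=> y; have <- : (y \in S) = (y \in connect e 1) by rewrite inE.
apply/idP/idP; apply: subsetP y.
  apply: subloop_gen_min => //; apply/subsetP => a; rewrite inE => gs_a.
  by rewrite -[a]mulg1; have [] := Sgs a 1 gs_a S1.
have [G1 GM] := is_subloopP _ (span_loopP gs).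
apply/subsetP => y; rewrite inE.
apply: (@connect_ind _ e (fun u => u \in span gs)) => // u v Gu.
case/mem_translates => a gs_a v_eq.
have Ga : a \in span gs.
  by apply: subsetP (sub_subloop_gen _) _ _; rewrite inE.
by case: v_eq => ->; [have [] := GM _ _ Ga Gu | have [] := GM _ _ Gu Ga].
Qed.

End FiniteLoops.

Lemma sum_nat_const_seq (T : Type) (r : seq T) n :
  \sum_(i <- r) n = size r * n.
Proof. by rewrite big_const_seq count_predT iter_addn_0 mulnC. Qed.

(** * Sets of bit sequences as tries, and graph search by evaluation *)

Inductive trie := Empty | Node of bool & trie & trie.

Fixpoint trie_mem t (s : bitseq) : bool :=
  match t, s with
  | Empty, _ => false
  | Node m _ _, [::] => m
  | Node _ l r, b :: s' => trie_mem (if b then r else l) s'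
  end.

Fixpoint trie_add t (s : bitseq) : trie :=
  let: (m, l, r) :=
    if t is Node m l r then (m, l, r) else (false, Empty, Empty) in
  match s with
  | [::] => Node true l r
  | b :: s' => if b then Node m l (trie_add r s') else Node m (trie_add l s') r
  end.

Lemma trie_mem_add t s s' :
  trie_mem (trie_add t s) s' = (s' == s) || trie_mem t s'.
Proof.
elim: s t s' => [|b s IHs] [|m l r] [|b' s'] //=;
  first [by case: b | by case: b' | by case: b; case: b' => /=; rewrite ?IHs].
Qed.

Lemma trie_mem_foldl_add t ss s :
  trie_mem (foldl trie_add t ss) s = (s \in ss) || trie_mem t s.
Proof.
elim: ss t => //= s1 ss IHss t; rewrite IHss trie_mem_add inE.
by rewrite orbA [(s \in ss) || _]orbC.
Qed.

Section CodeDfs.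
Variable g : bitseq -> seq bitseq.

(* [dfs] of fingraph, with a trie for the visited vertices so that it can be
   evaluated. *)
Fixpoint code_dfs n t s : trie :=
  if trie_mem t s then t else
  if n is n'.+1 then foldl (code_dfs n') (trie_add t s) (g s) else t.

Variables (T : finType) (code : T -> bitseq) (gT : T -> seq T).
Hypotheses (code_inj : injective code).
Hypothesis code_g : forall x, g (code x) = map code (gT x).

(** The invariant is that the trie [t] and the list [v] record the same visited vertices, so both
    searches take the same branches. *)
Lemma code_dfsE n t v x :
  (forall y, trie_mem t (code y) = (y \in v)) ->
  forall y, trie_mem (code_dfs n t (code x)) (code y) = (y \in dfs gT n v x).
Proof.
elim: n t v x => [|n IHn] t v x tv /=; first by rewrite if_same; case: ifP.
rewrite tv; case: ifP => // _; rewrite code_g.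
have: forall y, trie_mem (trie_add t (code x)) (code y) = (y \in x :: v).
  by move=> y; rewrite trie_mem_add (inj_eq code_inj) tv inE.
elim: (gT x) (trie_add _ _) (x :: v) => //= z zs IHzs t' v' tv'.
exact/IHzs/IHn.
Qed.

Lemma code_dfs_connect x y :
  trie_mem (code_dfs #|T| Empty (code x)) (code y) = connect (grel gT) x y.
Proof.
rewrite (@code_dfsE _ _ [::]) //.
by apply/dfsP/connectP.
Qed.

End CodeDfs.

(** * Eight-bit codes for Zorn matrices over $\mathbb F_2$ *)

Section Coding.
Import GRing.Theory.
Local Open Scope ring_scope.

Definition bit (c : 'F_2) : bool := c != 0.

Lemma F2P (c : 'F_2) : c = (bit c)%:R.
Proof. by case: c => [[|[|//]] lt_c]; apply: val_inj. Qed.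

Lemma bit_inj : injective bit.
Proof. by move=> c d eq_cd; rewrite [c]F2P eq_cd -F2P. Qed.

Lemma bit_nat (b : bool) : bit b%:R = b.
Proof. by case: b. Qed.

Lemma bitD (c d : 'F_2) : bit (c + d) = bit c (+) bit d.
Proof. by rewrite [c]F2P [d]F2P; case: (bit c); case: (bit d). Qed.

Lemma bitM (c d : 'F_2) : bit (c * d) = bit c && bit d.
Proof. by rewrite [c]F2P [d]F2P; case: (bit c); case: (bit d). Qed.

Lemma bitN (c : 'F_2) : bit (- c) = bit c.
Proof. by rewrite [c]F2P; case: (bit c). Qed.

Definition zorn_code (x : zorn 'F_2) : bitseq :=
  [:: bit (zul x); bit (zur x 0 0); bit (zur x 0 1); bit (zur x 0 2);
      bit (zdl x 0 0); bit (zdl x 0 1); bit (zdl x 0 2); bit (zdr x)].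

Lemma zorn_code_inj : injective zorn_code.
Proof.
move=> x y [a u0 u1 u2 v0 v1 v2 b].
by apply: zornP; [|apply: row3P|apply: row3P|]; apply: bit_inj.
Qed.

Definition code_zorn (s : bitseq) : zorn 'F_2 :=
  let c i : 'F_2 := (nth false s i)%:R in
  Zorn (c 0) (\row_(i < 3) c i.+1) (\row_(i < 3) c i.+4) (c 7).

Lemma code_zornK s : size s = 8 -> zorn_code (code_zorn s) = s.
Proof.
move=> s8; rewrite /zorn_code /= !mxE !bit_nat.
by case: s s8 => [|? [|? [|? [|? [|? [|? [|? [|? [|]]]]]]]]].
Qed.

(** The Zorn product in coordinates: addition in $\mathbb F_2$ is exclusive or, so the signs in the
    cross products disappear. Lists of a length other than 8 get the junk value [[::]]. *)
Definition code_mul (x y : bitseq) : bitseq :=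
  if (x, y) is ([:: a; p0; p1; p2; q0; q1; q2; b],
                [:: c; r0; r1; r2; s0; s1; s2; d]) then
  [:: a && c (+) (p0 && s0 (+) p1 && s1 (+) p2 && s2);
      a && r0 (+) d && p0 (+) (q1 && s2 (+) q2 && s1);
      a && r1 (+) d && p1 (+) (q2 && s0 (+) q0 && s2);
      a && r2 (+) d && p2 (+) (q0 && s1 (+) q1 && s0);
      c && q0 (+) b && s0 (+) (p1 && r2 (+) p2 && r1);
      c && q1 (+) b && s1 (+) (p2 && r0 (+) p0 && r2);
      c && q2 (+) b && s2 (+) (p0 && r1 (+) p1 && r0);
      (q0 && r0 (+) q1 && r1 (+) q2 && r2) (+) b && d]
  else [::].

Definition code_det (x : bitseq) : bool :=
  if x is [:: a; p0; p1; p2; q0; q1; q2; b] then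
    a && b (+) (p0 && q0 (+) p1 && q1 (+) p2 && q2)
  else false.

Lemma zorn_codeM x y :
  zorn_code (zorn_mul x y) = code_mul (zorn_code x) (zorn_code y).
Proof.
case: x y => [a u v b] [c w z d].
by rewrite /zorn_code /= !(cross3E, dot3E, mxE) !(bitD, bitM, bitN).
Qed.

Lemma code_detE x : code_det (zorn_code x) = bit (zorn_det x).
Proof.
by case: x => [a u v b]; rewrite /zorn_det /= dot3E !(bitD, bitM, bitN).
Qed.

End Coding.

Fixpoint bitseqs n : seq bitseq :=
  if n is n'.+1 then
    map (cons false) (bitseqs n') ++ map (cons true) (bitseqs n')
  else [:: [::]].

Lemma mem_bitseqs n s : (s \in bitseqs n) = (size s == n).
Proof.
have mem_cons b c t r : (b :: t \in map (cons c) r) = (b == c) && (t \in r).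
  by apply/mapP/andP => [[u r_u [-> ->]]|[/eqP-> r_t]]; last exists t.
elim: n s => [|n IHn] [|b s] //=; rewrite mem_cat.
  by apply/negP => /orP[] /mapP[].
by rewrite !mem_cons IHn eqSS; case: b; rewrite ?orbF.
Qed.

Definition paige_codes : seq bitseq := [seq s <- bitseqs 8 | code_det s].
Arguments paige_codes : simpl never.

Lemma size_paige_codes : size paige_codes = 120.
Proof. by vm_compute. Qed.

Lemma uniq_paige_codes : uniq paige_codes.
Proof. by vm_compute. Qed.

(** * The elements of $M^*(2)$ and their codes *)

Section Paige.
Local Open Scope group_scope.
Implicit Types x y z : paige2.

Definition paige_code x : bitseq := zorn_code x.
Definition code_paige (s : bitseq) : paige2 :=
  insubd (1 : paige2) (code_zorn s).
Definition paige_elts : seq paige2 := [seq code_paige s | s <- paige_codes].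

Lemma paige_code_inj : injective paige_code.
Proof. by move=> x y /zorn_code_inj /val_inj. Qed.

Lemma paige_codeM x y :
  paige_code (x * y) = code_mul (paige_code x) (paige_code y).
Proof. exact: zorn_codeM. Qed.

Lemma mem_paige_codes x : paige_code x \in paige_codes.
Proof. by rewrite mem_filter mem_bitseqs code_detE paige2_detE. Qed.

Lemma code_paigeK s : s \in paige_codes -> paige_code (code_paige s) = s.
Proof.
rewrite mem_filter mem_bitseqs => /andP[det_s /eqP size_s].
(* The decoded matrix has determinant 1, so [insubd] does not fall back on its default. *)
rewrite /paige_code /code_paige val_insubd [zorn_det _ == _](_ : _ = true).
  exact: code_zornK.
apply/eqP; rewrite [LHS]F2P.
by rewrite -code_detE code_zornK // det_s.
Qed.

Lemma paige_codeK : cancel paige_code code_paige.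
Proof.
by move=> x; apply: paige_code_inj; rewrite code_paigeK // mem_paige_codes.
Qed.

Lemma map_paige_elts : map paige_code paige_elts = paige_codes.
Proof.
rewrite -map_comp -[RHS]map_id; apply/eq_in_map => s s_in /=.
exact: code_paigeK.
Qed.

Lemma mem_paige_elts x : x \in paige_elts.
Proof.
apply/mapP.
by exists (paige_code x); rewrite ?mem_paige_codes ?paige_codeK.
Qed.

Lemma perm_paige_elts : perm_eq (index_enum paige2) paige_elts.
Proof.
apply: uniq_perm; first exact: index_enum_uniq.
  by rewrite -(map_inj_uniq paige_code_inj) map_paige_elts uniq_paige_codes.
by move=> x; rewrite mem_index_enum mem_paige_elts.
Qed.

Lemma card_paige2 : #|{: paige2}| = 120.
Proof.
rewrite -size_paige_codes -map_paige_elts size_map -(perm_size perm_paige_elts).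
by rewrite cardE enumT.
Qed.

(** * Moufang identities and conjugation by elements with $x^3=1$ *)

Lemma paige2_invM x y : paige2_inv (x * y) = paige2_inv y * paige2_inv x.
Proof.
have xyVx : paige2_inv (x * y) * x = paige2_inv y.
  by rewrite -{2}(paige2_mulKr x y) paige2_mulKl.
by rewrite -xyVx paige2_mulKr.
Qed.

(** This is [paige2_moufang] with $y$ and $z$ replaced by $(yx)^{-1}$ and $(yx)z$, followed by left
    multiplication by $y$. *)
Lemma paige2_rmoufang x y z : ((y * x) * z) * x = y * ((x * z) * x).
Proof.
have := paige2_moufang x (paige2_inv (y * x)) (y * x * z).
by rewrite paige2_mulKl paige2_invM paige2_mulVKl => <-; rewrite paige2_mulVKl.
Qed.

Section Cubes.
Variable x : paige2.
Hypothesis x3 : x * (x * x) = 1.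

Definition cube_conj y := (x * y) * (x * x).

Lemma cube_conj_inj : injective cube_conj.
Proof. by move=> y z /loop_mulIr/loop_mulI. Qed.

(* Here x * x is the inverse of x, and the two Moufang identities give
   (y x^-1)(x z x) = (y z) x = (y z) x^-2. *)
Lemma cube_conjM : {morph cube_conj : y z / y * z}.
Proof.
have flex y : x * (y * x) = (x * y) * x.
  by have := paige2_moufang x 1 y; rewrite mulg1 mul1g.
have alt y : (y * x) * x = y * (x * x).
  by have := paige2_rmoufang x y 1; rewrite !mulg1.
have mulK y : (y * x) * (x * x) = y.
  by apply: (@loop_mulIr _ x); rewrite /= paige2_rmoufang x3 mul1g.
have mulVK y : (y * (x * x)) * x = y.
  by apply: (@loop_mulIr _ (x * x)); rewrite /= mulK.
have lmulV y : x * (y * (x * x)) = (x * y) * (x * x).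
  by apply: (@loop_mulIr _ x); rewrite /= -flex !mulVK.
move=> y z; rewrite /cube_conj -(lmulV y).
rewrite -[(x * z) * _]mulVK (paige2_moufang x (y * (x * x))).
have -> : ((x * z) * (x * x)) * (x * x) = (x * z) * x.
  by rewrite -{1}[(x * z) * (x * x)]alt mulK.
by rewrite -paige2_rmoufang mulVK flex alt.
Qed.

End Cubes.

(** * Orbits under these conjugations *)

Definition cubes := [seq x <- paige_elts | x * (x * x) == 1].

(** Each edge applies an automorphism, and automorphisms preserve the number of completions. *)
Lemma connect_cube_conj k x y :
  connect (grel (fun z => [seq cube_conj c z | c <- cubes])) x y ->
  completions k [:: y] = completions k [:: x].
Proof.
apply: (@connect_ind _ _ (fun y => completions k [:: y] = _)) => // u v <-.
case/mapP => c; rewrite mem_filter => /andP[/eqP c3 _] ->.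
by rewrite -[[:: _]]/(map _ [:: _]) completions_morph //;
  [apply: cube_conj_inj | apply: cube_conjM].
Qed.

Definition code_one : bitseq :=
  [:: true; false; false; false; false; false; false; true].
(** A Zorn matrix of determinant 1 satisfies $x^2=tx-1$, where $t=a+b$ is its trace. Here $t=0$, so
    $x^2=1$ over $\mathbb F_2$; for [code_cubic], $t=1$ and $x^3=1$. *)
Definition code_invol : bitseq :=
  [:: false; true; false; false; true; false; false; false].
Definition code_cubic : bitseq :=
  [:: true; true; false; false; true; false; false; false].

Definition code_class : bitseq -> trie :=
  let cubes :=
    [seq s <- paige_codes | code_mul s (code_mul s s) == code_one] in
  code_dfs (fun s => [seq code_mul (code_mul c s) (code_mul c c) | c <- cubes])
    120 Empty.

Lemma paige_code1 : paige_code 1 = code_one.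
Proof. by rewrite /paige_code /zorn_code /= !mxE. Qed.

Lemma code_classE x y :
  trie_mem (code_class (paige_code x)) (paige_code y) =
  connect (grel (fun z => [seq cube_conj c z | c <- cubes])) x y.
Proof.
(* The fuel 120 is the order of the loop, as [code_dfs_connect] requires. *)
rewrite /code_class -card_paige2; apply: code_dfs_connect => [|z].
  exact: paige_code_inj.
have -> : [seq s <- paige_codes | code_mul s (code_mul s s) == code_one] =
    map paige_code cubes.
  rewrite -map_paige_elts filter_map; congr map; apply: eq_filter => c.
  by rewrite /= -!paige_codeM -paige_code1 (inj_eq paige_code_inj).
rewrite -!map_comp; apply: eq_map => c.
by rewrite /= !paige_codeM.
Qed.

Definition class_codes s : seq bitseq :=
  filter (trie_mem (code_class s)) paige_codes.

Lemma sum_class_codes k s : s \in paige_codes ->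
  (\sum_(y <- class_codes s) completions k [:: code_paige y] =
   size (class_codes s) * completions k [:: code_paige s])%N.
Proof.
move=> s_in; rewrite -sum_nat_const_seq [LHS]big_seq [RHS]big_seq.
apply: eq_bigr => y; rewrite mem_filter => /andP[s_y y_in].
apply: connect_cube_conj; rewrite -code_classE (code_paigeK s_in).
rewrite (code_paigeK y_in); exact s_y.
Qed.

(** Transitivity is observed by evaluation: both orbits are computed by search and compared with the
    list of all codes. *)
Lemma perm_class_codes :
  perm_eq paige_codes
    (code_one :: class_codes code_invol ++ class_codes code_cubic).
Proof. by vm_compute. Qed.

Lemma size_class_invol : size (class_codes code_invol) = 63.
Proof. by vm_compute. Qed.

Lemma size_class_cubic : size (class_codes code_cubic) = 56.
Proof. by vm_compute. Qed.

Lemma mem_code_invol : code_invol \in paige_codes.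
Proof. by vm_compute. Qed.

Lemma mem_code_cubic : code_cubic \in paige_codes.
Proof. by vm_compute. Qed.

(** The first generator is 1 or lies in one of the two orbits; a leading 1 does not enlarge the span
    of the empty list. *)
Lemma completions_nilS k :
  completions k.+1 ([::] : seq paige2) =
  (completions k ([::] : seq paige2)
   + 63 * completions k [:: code_paige code_invol]
   + 56 * completions k [:: code_paige code_cubic])%N.
Proof.
rewrite completionsS (perm_big _ perm_paige_elts) big_map.
rewrite (perm_big _ perm_class_codes).
rewrite big_cons big_cat -addnA; congr (_ + (_ + _))%N.
- by rewrite -paige_code1 paige_codeK completions_cons1.
- by rewrite (sum_class_codes _ mem_code_invol) size_class_invol.
- by rewrite (sum_class_codes _ mem_code_cubic) size_class_cubic.
Qed.

(** * Counting completions by evaluation *)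

Definition code_span gs : trie :=
  code_dfs
    (fun s => [seq code_mul g s | g <- gs] ++ [seq code_mul s g | g <- gs])
    120 Empty code_one.

Lemma code_spanE gs x :
  trie_mem (code_span (map paige_code gs)) (paige_code x) =
  (x \in span gs).
Proof.
rewrite (span_translates _ paige2_moufang) /code_span -card_paige2.
rewrite -paige_code1; apply: code_dfs_connect => [|y].
  exact: paige_code_inj.
rewrite map_cat -!map_comp; congr (_ ++ _); apply: eq_map => g /=;
  exact/esym/paige_codeM.
Qed.

(* Sums F over ss, calling F only once on each coset Hs; n is fuel. *)
Fixpoint coset_sum (F : bitseq -> nat) (H : seq bitseq) n ss : nat :=
  if (n, ss) is (n'.+1, s :: _) then
    let Hs := foldl trie_add Empty [seq code_mul h s | h <- H] in
    let ss' := [seq s' <- ss | ~~ trie_mem Hs s'] in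
    ((size ss - size ss') * F s + coset_sum F H n' ss')%N
  else 0.

(** Each round removes the members of one coset that are still listed and weights their common value
    by their number, so overlapping cosets are not counted twice. *)
Lemma coset_sumE F (FT : paige2 -> nat) (H : seq paige2) n xs :
  (forall x, F (paige_code x) = FT x) ->
  1 \in H -> (forall h x, h \in H -> FT (h * x) = FT x) -> size xs <= n ->
  coset_sum F (map paige_code H) n (map paige_code xs) =
  (\sum_(x <- xs) FT x)%N.
Proof.
move=> FE H1 FH; elim: n xs => [|n IHn] [|x xs] //; rewrite ?big_nil // => le_n.
pose a y := y \in [seq h * x | h <- H].
have ax : a x by apply/mapP; exists 1; rewrite ?mul1g.
pose ss := map paige_code (x :: xs).
pose Hx := foldl trie_add Empty
  [seq code_mul h (paige_code x) | h <- map paige_code H].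
pose ss' := [seq s <- ss | ~~ trie_mem Hx s].
have -> : coset_sum F (map paige_code H) n.+1 ss =
    ((size ss - size ss') * F (paige_code x)
     + coset_sum F (map paige_code H) n ss')%N by [].
have -> : ss' = map paige_code (filter (predC a) (x :: xs)).
  rewrite /ss' filter_map; congr map; apply: eq_filter => y /=; congr (~~ _).
  rewrite trie_mem_foldl_add orbF /a -[RHS](mem_map paige_code_inj) -!map_comp.
  by congr (_ \in _); apply: eq_map => h /=; rewrite paige_codeM.
have sizeC := count_predC a (x :: xs).
(* As $1\in H$, [x] lies in its own coset, so the list gets shorter and the remaining fuel
   suffices. *)
rewrite FE !size_map IHn; last first.
  rewrite -ltnS (leq_trans _ le_n) // -sizeC size_filter /=.
  by rewrite ax addSn ltnS leq_addl.
have /permPl permC := perm_filterC a (x :: xs).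
rewrite -(perm_big _ permC) big_cat; congr addn.
(* The difference of lengths counts the listed members of the coset, on each of which [FT] takes the
   value [FT x]. *)
rewrite -{1}sizeC size_filter addnK -size_filter -sum_nat_const_seq.
rewrite !big_filter; apply: eq_bigr => y /mapP[h Hh ->].
by rewrite FH.
Qed.

(** The fuel 120 is the number of codes, enough even if every round removes a single one. *)
Fixpoint count_completions k (gs : seq bitseq) : nat :=
  let H := code_span gs in
  if k is k'.+1 then
    coset_sum (fun s => count_completions k' (s :: gs))
      (filter (trie_mem H) paige_codes) 120 paige_codes
  else all (trie_mem H) paige_codes.

Lemma count_completionsS k gs :
  count_completions k.+1 gs =
  coset_sum (fun s => count_completions k (s :: gs))
    (filter (trie_mem (code_span gs)) paige_codes) 120 paige_codes.
Proof. by []. Qed.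

Lemma count_completions0 gs :
  count_completions 0 (map paige_code gs) = completions 0 gs.
Proof.
rewrite /count_completions /completions -map_paige_elts all_map -subTset.
congr nat_of_bool.
apply/allP/subsetP => genT x _; last by rewrite /= code_spanE genT ?in_setT.
rewrite -code_spanE; exact: genT (mem_paige_elts x).
Qed.

Lemma count_completionsE k (gs : seq paige2) :
  count_completions k (map paige_code gs) = completions k gs.
Proof.
elim: k gs => [|k IHk] gs; first exact: count_completions0.
rewrite count_completionsS completionsS (perm_big _ perm_paige_elts).
set H := code_span _.
have HE : filter (trie_mem H) paige_codes =
    map paige_code [seq x <- paige_elts | x \in span gs].
  rewrite -map_paige_elts filter_map; congr map.
  by apply: eq_filter => x /=; rewrite code_spanE.
rewrite HE -map_paige_elts.
apply: (@coset_sumE _ (fun x => completions k (x :: gs))) => [x||h x|].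
- by rewrite -map_cons IHk.
- rewrite mem_filter mem_paige_elts andbT.
  by have [] := is_subloopP _ (span_loopP gs).
- rewrite mem_filter => /andP[+ _] => /span_coset eq_gen.
  exact: eq_completions.
- by rewrite -(size_map paige_code) map_paige_elts size_paige_codes.
Qed.

Lemma completions_code k s : s \in paige_codes ->
  completions k [:: code_paige s] = count_completions k [:: s].
Proof.
by move=> s_in; rewrite -count_completionsE [map _ _]/= (code_paigeK s_in).
Qed.

(** All values come from evaluation. The zeros agree with Moufang's theorem: two elements generate a
    group, while this loop is not associative. *)
Lemma completions_invol k :
  k < 3 -> completions k [:: code_paige code_invol] = nth 0 [:: 0; 0; 6528] k.
Proof.
move=> lt_k3; rewrite (completions_code _ mem_code_invol).
by case: k lt_k3 => [|[|[|//]]] _; apply/eqP; vm_compute.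
Qed.

Lemma completions_cubic k :
  k < 3 -> completions k [:: code_paige code_cubic] = nth 0 [:: 0; 0; 9720] k.
Proof.
move=> lt_k3; rewrite (completions_code _ mem_code_cubic).
by case: k lt_k3 => [|[|[|//]]] _; apply/eqP; vm_compute.
Qed.

Lemma completions0_nil : completions 0 ([::] : seq paige2) = 0.
Proof.
rewrite -(count_completionsE 0 [::]).
by apply/eqP; vm_compute.
Qed.

Lemma card_Gen_paige2 : #|Gen paige2 3| = (63 * 6528 + 56 * 9720)%N.
Proof.
(* The terms for a leading 1 unfold down to [completions 0 [::]], which is 0. Terms with fewer than
   two further generators vanish too, so only those with [k = 2] remain. *)
rewrite card_Gen 3!completions_nilS completions0_nil.
rewrite !(@completions_invol 0, @completions_invol 1, @completions_invol 2) //.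
by rewrite !(@completions_cubic 0, @completions_cubic 1, @completions_cubic 2).
Qed.

End Paige.

(** * Arithmetic: 0.553 is the exact value of the quotient, not a rounded one *)

Section Numerals.
Import GRing.Theory.
Local Open Scope ring_scope.

Lemma numeral_955584 : (63 * 6528 + 56 * 9720)%N = 955584%N.
Proof. by apply/eqP; vm_compute. Qed.

Lemma eq_natr_div n m (q : rat) : n = m -> n%:R / q = m%:R / q.
Proof. by move=> ->. Qed.

Lemma natr_lin2 (R : pzSemiRingType) (a b c d : nat) :
  (a * b + c * d)%:R = a%:R * b%:R + c%:R * d%:R :> R.
Proof. by rewrite natrD !natrM. Qed.

Lemma decimal_0553 : 0.553%Q = 553%:R / 10%:R ^+ 3.
Proof. by apply/eqP; vm_compute. Qed.

(* The terms are given explicitly because unification on these unary numerals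
   overflows the stack. *)
Lemma prob_decimal n : n = (63 * 6528 + 56 * 9720)%N ->
  n%:R * 120%:R ^- 3 = 0.553%Q :> rat.
Proof.
move=> ->; apply: etrans (esym decimal_0553).
apply: etrans (congr1 (fun q => q * 120%:R ^- 3)
                      (natr_lin2 rat 63 6528 56 9720)) _.
by field.
Qed.

End Numerals.

Local Open Scope ring_scope.

Theorem proposition2p3 :
  gen_prob paige2 3 = 955584%:R * 120%:R ^- 3 /\
  955584%:R * 120%:R ^- 3 = 0.553%Q.
Proof.
split; last exact: prob_decimal (esym numeral_955584).
rewrite /gen_prob card_paige2.
exact: eq_natr_div (etrans card_Gen_paige2 numeral_955584).
Qed.
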